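(* Let $F$ be a divisibly closed supertropical semifield, and suppose $f\in F[\lambda_1,\dots,\lambda_n]$ is not a tangible monomial. Then $f$ has a tangible root.
   Context: All semirings are commutative (in both operations), with zero $0_R$ and unit $1_R$. A supertropical semiring is a triple $(R,\mathcal G_0,\nu)$ where $R$ is a semiring, $\mathcal G_0=\mathcal G\cup\{0_R\}$ is a semiring ideal of $R$ (the ghost ideal), and $\nu:R\to\mathcal G_0$ (written $a^\nu=\nu(a)$) is a semiring homomorphism with $\nu^2=\nu$ (where $\mathcal G_0$ is a semiring with unit $\nu(1_R)$), such that: $a+a=a^\nu$ for all $a$; $a+b\in\{a,b\}$ whenever $a^\nu\ne b^\nu$; and $a+b=a^\nu$ whenever $a^\nu=b^\nu$. It is a supertropical domain if the set $\mathcal T=R\setminus\mathcal G_0$ of tangible elements is a multiplicative monoid and $\nu|_{\mathcal T}:\mathcal T\to\mathcal G$ is onto; it is a supertropical semifield if moreover $\mathcal T$ is an Abelian group. The divisible closure $\bar R$ of a supertropical domain $R$ consists of formal roots $\sqrt[m]{a}$ ($a\in R$, $m\ge1$), with $\sqrt[m]{a}=\sqrt[m']{b}$ when $a^{m'n}=b^{mn}$ for some $n\ge 1$, product $\sqrt[m]{a}\sqrt[m']{b}=\sqrt[mm']{a^{m'}b^m}$, sum $\sqrt[m]{a}+\sqrt[m']{b}=\sqrt[mm']{a^{m'}+b^m}$, and $\nu(\sqrt[m]{a})=\sqrt[m]{a^\nu}$. $R$ is divisibly closed if $\bar R=R$ (identifying $a$ with $\sqrt[1]{a}$). $F[\lambda_1,\dots,\lambda_n]$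 is the semiring of functions $F^{(n)}\to F$ defined by polynomials with coefficients in $F$ (polynomials defining the same function are identified). A tangible monomial is $\alpha\lambda_1^{i_1}\cdots\lambda_n^{i_n}$ with $\alpha\in\mathcal T$. A point $\mathbf a\in F^{(n)}$ is a root of $f$ if $f(\mathbf a)\in\mathcal G_0$; it is tangible if each coordinate is in $\mathcal T$ or is $0_F$. *)

(* Defs.v *)
From HB Require Import structures.
From mathcomp Require Import all_boot all_order all_algebra.
From mathcomp Require Import boolp.

Set Implicit Arguments.
Unset Strict Implicit.
Unset Printing Implicit Defensive.

Import GRing.Theory.
Local Open Scope ring_scope.
Local Open Scope quotient_scope.

(* [nu] is typed R -> R; [nu_ghost0] says that it lands in the ghost ideal.
   It is not an {rmorphism R -> R}: the unit of the semiring [ghost0] is [nu 1],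
   not 1, so a semiring homomorphism onto it is one preserving 0, + and *. *)
HB.mixin Record isSupertropical R of GRing.ComPzSemiRing R := {
  ghost0 : {pred R};
  nu : R -> R;
  ghost0_0 : 0 \in ghost0;
  ghost0D : {in ghost0 &, forall a b, a + b \in ghost0};
  ghost0M : forall a b, b \in ghost0 -> a * b \in ghost0;
  ghost0_unit : {in ghost0, forall b, nu 1 * b = b};
  nu_ghost0 : forall a, nu a \in ghost0;
  nu0 : nu 0 = 0;
  nuD : {morph nu : a b / a + b};
  nuM : {morph nu : a b / a * b};
  nu_idem : forall a, nu (nu a) = nu a;
  addaa : forall a : R, a + a = nu a;
  add_bipotent : forall a b : R, nu a <> nu b -> a + b = a \/ a + b = b;
  add_nu_eq : forall a b : R, nu a = nu b -> a + b = nu a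
}.

#[short(type="supertropicalType")]
HB.structure Definition Supertropical :=
  {R of isSupertropical R & GRing.ComPzSemiRing R}.

Definition tangible (R : supertropicalType) : {pred R} :=
  [pred a | a \notin (ghost0 : {pred R})].

Definition ghost (R : supertropicalType) : {pred R} :=
  [pred a | (a \in (ghost0 : {pred R})) && (a != 0)].

HB.mixin Record isSupertropicalDomain R of Supertropical R := {
  tangible_closed : mulr_closed (@tangible R);
  nu_tangible : {in @tangible R, forall a, nu a \in @ghost R};
  nu_onto : {in @ghost R, forall g, exists2 a, a \in @tangible R & nu a = g}
}.

#[short(type="supertropicalDomainType")]
HB.structure Definition SupertropicalDomain :=
  {R of isSupertropicalDomain R & Supertropical R}.

HB.mixin Record isSupertropicalSemifield R of SupertropicalDomain R := {
  tangible_inv :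
    {in @tangible R, forall a, exists2 b, b \in @tangible R & a * b = 1}
}.

#[short(type="supertropicalSemifieldType")]
HB.structure Definition SupertropicalSemifield :=
  {R of isSupertropicalSemifield R & SupertropicalDomain R}.

Section DivisibleClosure.
Variable R : supertropicalDomainType.

(* The pair (a, m) is the formal root $\sqrt[m]{a}$, m >= 1. *)
Definition formal_root : Type := (R * {m : nat | (0 < m)%N})%type.

HB.instance Definition _ := Choice.on formal_root.

Definition root_eq (x y : formal_root) : bool :=
  `[< exists n : nat, (0 < n)%N /\
      x.1 ^+ (val y.2 * n) = y.1 ^+ (val x.2 * n) >].

Lemma root_eq_refl : reflexive root_eq.
Proof. by move=> x; apply/asboolP; exists 1%N. Qed.

Lemma root_eq_sym : symmetric root_eq.
Proof.
by move=> x y; apply/asboolP/asboolP => -[n [n0 e]]; exists n; rewrite e.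
Qed.

Lemma root_eq_trans : transitive root_eq.
Proof.
move=> [b [m' m'0]] [a [m m0]] [c [p p0]] /asboolP[/= n [n0 e1]].
move=> /asboolP[/= k [k0 e2]]; apply/asboolP.
exists (m' * n * k)%N; split => /=; first by rewrite !muln_gt0 m'0 n0.
have -> : (p * (m' * n * k) = m' * n * (p * k))%N.
  by rewrite mulnCA.
rewrite exprM e1 -exprM mulnC -mulnA.
have -> : (p * (k * (m * n)) = p * k * (m * n))%N by rewrite mulnA.
rewrite exprM e2 -exprM; congr (_ ^+ _).
by rewrite -!mulnA [RHS]mulnCA; congr (_ * _)%N; rewrite mulnC -mulnA.
Qed.

Canonical root_equiv := EquivRel root_eq root_eq_refl root_eq_sym root_eq_trans.

Definition divisible_closure := {eq_quot root_equiv}.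

Definition root1 (a : R) : divisible_closure :=
  \pi_divisible_closure ((a, exist _ 1%N isT) : formal_root).

(* The product, sum and ghost map of the closure, when evaluated on the roots
   $\sqrt[1]{a}$, are literally those of R, so [root1] is an identification of R
   with its divisible closure as soon as it is a bijection. *)
Definition divisibly_closed : Prop := bijective root1.

End DivisibleClosure.

Definition monomial (R : comPzSemiRingType) (n : nat)
    (alpha : R) (i : 'I_n -> nat) (x : 'I_n -> R) : R :=
  alpha * \prod_(k < n) x k ^+ i k.

(* Membership in $F[\lambda_1,\dots,\lambda_n]$: the finite list s holds the
   coefficients and exponents of a polynomial defining the function f. *)
Definition polynomial_function (R : comPzSemiRingType) (n : nat)
    (f : ('I_n -> R) -> R) : Prop :=
  exists s : seq (R * ('I_n -> nat)),
    forall x, f x = \sum_(c <- s) monomial c.1 c.2 x.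

Definition tangible_monomial (R : supertropicalType) (n : nat)
    (f : ('I_n -> R) -> R) : Prop :=
  exists (alpha : R) (i : 'I_n -> nat),
    alpha \in @tangible R /\ forall x, f x = monomial alpha i x.

Definition is_root (R : supertropicalType) (n : nat)
    (f : ('I_n -> R) -> R) (x : 'I_n -> R) : Prop :=
  f x \in (ghost0 : {pred R}).

Definition tangible_point (R : supertropicalType) (n : nat)
    (x : 'I_n -> R) : Prop :=
  forall k, x k \in @tangible R \/ x k = 0.

(* Main.v *)
Require Import Defs.
From mathcomp Require Import all_boot all_order all_algebra.
From mathcomp Require Import boolp.

(** A polynomial without constant term vanishes at the origin, and 0 is a ghost
    root; more generally, the origin is a tangible root unless the constant
    term [c] is tangible. So let [c] be tangible. If all other coefficients
    vanish, the function is the constant [c], which is a tangible monomial.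
    Otherwise restrict to the diagonal, i.e. to the points (t, ..., t), where the
    nonconstant part becomes a one-variable polynomial S(t) with S(0) = 0. Its
    ghost value is a monotone function of t, so an intermediate value argument
    gives a tangible t at which S(t) and [c] have the same ghost value
    ([nu_sum_attains]); there c + S(t) = nu c is ghost.

    For a single term [a * t ^+ d] the equation for the ghost values is solved
    by extracting a d-th root, which is where divisible closure enters
    ([exists_tangible_root]). For a sum, the smallest of the solutions belonging
    to the single terms works: there one term has the ghost value of [c] and, by
    monotonicity, no other term exceeds it. *)

Set Implicit Arguments.
Unset Strict Implicit.
Unset Printing Implicit Defensive.

Import GRing.Theory.
Local Open Scope ring_scope.
Local Open Scope quotient_scope.

Section NuOrder.
Variable R : supertropicalType.
Implicit Types a b c : R.

(** The order of the ghost ideal, pulled back along [nu]: addition of ghosts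
    is their maximum. *)
Definition nu_le a b : Prop := nu a + nu b = nu b.

Lemma nu_le_refl a : nu_le a a.
Proof. by rewrite /nu_le addaa nu_idem. Qed.

Lemma nu_le_total a b : nu_le a b \/ nu_le b a.
Proof.
have [e|ne] := pselect (nu a = nu b).
  by left; rewrite /nu_le e; apply: nu_le_refl.
have ne' : nu (nu a) <> nu (nu b) by rewrite !nu_idem.
case: (add_bipotent _ _ ne') => e; last by left.
by right; rewrite /nu_le addrC.
Qed.

Lemma nu_leD a b a' b' : nu_le a a' -> nu_le b b' -> nu_le (a + b) (a' + b').
Proof. by rewrite /nu_le !nuD addrACA => -> ->. Qed.

Lemma nu_leM2l c a b : nu_le a b -> nu_le (c * a) (c * b).
Proof. by rewrite /nu_le !nuM -mulrDr => ->. Qed.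

Lemma nu_le_trans b a c : nu_le a b -> nu_le b c -> nu_le a c.
Proof. by rewrite /nu_le => ab bc; rewrite -bc addrA ab. Qed.

Lemma nu_leX a b d : nu_le a b -> nu_le (a ^+ d) (b ^+ d).
Proof.
move=> ab; elim: d => [|d IH]; first exact: nu_le_refl.
rewrite !exprS; apply: (nu_le_trans (b := a * b ^+ d)); first exact: nu_leM2l.
by rewrite ![_ * b ^+ d]mulrC; apply: nu_leM2l.
Qed.

Lemma nu_le_sum (s : seq (R * nat)) a b : nu_le a b ->
  nu_le (\sum_(p <- s) p.1 * a ^+ p.2) (\sum_(p <- s) p.1 * b ^+ p.2).
Proof.
move=> ab; elim: s => [|p s IH]; first by rewrite !big_nil; apply: nu_le_refl.
by rewrite !big_cons; apply: nu_leD IH; apply/nu_leM2l/nu_leX.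
Qed.

End NuOrder.

(** Surjectivity of the identification of R with its closure gives a root up to
    a common power, and injectivity cancels that power. *)
Lemma divisibly_closed_root (R : supertropicalDomainType) (a : R) (m : nat) :
  divisibly_closed R -> (0 < m)%N -> exists b, b ^+ m = a.
Proof.
move=> [g r1K gK] m0.
pose x : formal_root R := (a, exist _ m m0).
have /eqmodP /asboolP[/= n [n0 e]] := gK (\pi_(divisible_closure R) x).
exists (g (\pi_(divisible_closure R) x)).
apply: (can_inj r1K); apply/eqmodP/asboolP; exists n; split => //=.
by rewrite !mul1n -exprM e mul1n.
Qed.

(** Ghosts form an ideal, so the powers of a ghost are ghosts; hence a root of a
    tangible element is tangible. *)
Lemma exists_tangible_root (R : supertropicalDomainType) (a : R) (m : nat) :
  divisibly_closed R -> (0 < m)%N -> a \in @tangible R ->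
  exists2 b, b \in @tangible R & b ^+ m = a.
Proof.
move=> Rdiv m0 aT; have [b ba] := divisibly_closed_root a Rdiv m0.
exists b => //; move: aT; rewrite -ba; apply: contra => bG.
by case: m m0 {ba} => // m _; rewrite exprSr; apply: ghost0M.
Qed.

Lemma exists_tangible_lift (R : supertropicalDomainType) (a : R) : a != 0 ->
  exists2 b, b \in @tangible R & nu b = nu a.
Proof.
move=> a0; have [aT|] := boolP (a \in @tangible R); first by exists a.
rewrite negbK => aG; have aG' : a \in @ghost R by rewrite inE aG.
by have [b bT ba] := nu_onto a aG'; exists b; rewrite // -ba nu_idem.
Qed.

(** A ghost coefficient is not invertible, but only its ghost value matters, so
    it may be replaced by a tangible lift [b]; then [t] is a root of c / b. *)
Lemma nu_term_attains (F : supertropicalSemifieldType) (a c : F) (d : nat) :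
  divisibly_closed F -> (0 < d)%N -> a != 0 -> c \in @tangible F ->
  exists2 t, t \in @tangible F & nu (a * t ^+ d) = nu c.
Proof.
move=> Fdiv d0 a0 cT; have [b bT ba] := exists_tangible_lift a0.
have [b' b'T bb'] := tangible_inv b bT.
have b'cT : b' * c \in @tangible F by apply: (tangible_closed.2).
have [t tT te] := exists_tangible_root Fdiv d0 b'cT.
by exists t; rewrite // te nuM -ba -nuM mulrA bb' mul1r.
Qed.

(** The intermediate value argument. Adding a term to the sum, one keeps the
    smaller of the old solution and the solution for the new term: by
    monotonicity the summand solved by the other one is then at most [c]. *)
Lemma nu_sum_attains (F : supertropicalSemifieldType) (c : F)
    (s : seq (F * nat)) :
  divisibly_closed F -> c \in @tangible F ->
  all (fun p => 0 < p.2)%N s -> has (fun p => p.1 != 0) s ->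
  exists2 t, t \in @tangible F & nu (\sum_(p <- s) p.1 * t ^+ p.2) = nu c.
Proof.
move=> Fdiv cT; elim: s => //= -[a d] s IH /= /andP[d0 sd].
have [-> /= sn0|a0 _] := eqVneq a 0.
  by have [t tT te] := IH sd sn0; exists t; rewrite // big_cons mul0r add0r.
have [t0 t0T t0e] := nu_term_attains Fdiv d0 a0 cT.
have [sn0|s0] := boolP (has (fun p => p.1 != 0) s); last first.
  exists t0; rewrite // big_cons big1_seq ?addr0 // => p /= ps.
  by move/hasPn: s0 => /(_ p ps); rewrite negbK => /eqP ->; rewrite mul0r.
have [t1 t1T t1e] := IH sd sn0.
have [le01|le10] := nu_le_total t0 t1.
  exists t0; rewrite // big_cons nuD /= t0e addrC.
  by have := nu_le_sum s le01; rewrite /nu_le t1e.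
exists t1; rewrite // big_cons nuD /= t1e.
by have := nu_leM2l a (nu_leX d le10); rewrite /nu_le t0e.
Qed.

Section Monomials.
Variables (R : comPzSemiRingType) (n : nat).
Implicit Types (alpha t : R) (i : 'I_n -> nat).

Lemma monomial_diag alpha i t :
  monomial alpha i (fun=> t) = alpha * t ^+ (\sum_k i k).
Proof. by rewrite /monomial; congr (_ * _); rewrite -expr_sum. Qed.

Lemma monomial_deg0 alpha i (x : 'I_n -> R) :
  (\sum_k i k)%N = 0%N -> monomial alpha i x = alpha.
Proof.
move=> /eqP; rewrite sum_nat_eq0 => /forallP i0.
by rewrite /monomial big1 ?mulr1 // => k _; rewrite (eqP (i0 k)).
Qed.

End Monomials.

Theorem proposition5p17 (F : supertropicalSemifieldType) (n : nat)
    (f : ('I_n -> F) -> F) :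
  divisibly_closed F ->
  polynomial_function f ->
  ~ tangible_monomial f ->
  exists a : 'I_n -> F, tangible_point a /\ is_root f a.
Proof.
move=> Fdiv [s fE] fNmon.
pose deg (p : F * ('I_n -> nat)) := (\sum_k p.2 k)%N.
pose c := \sum_(p <- s | deg p == 0%N) p.1.
pose s1 := [seq (p.1, deg p) | p <- s & deg p != 0%N].
have f_split x :
    f x = c + \sum_(p <- s | deg p != 0%N) monomial p.1 p.2 x.
  rewrite fE (bigID (fun p => deg p == 0%N)) /=; congr (_ + _).
  by apply: eq_bigr => p /eqP p0; rewrite monomial_deg0.
have f_diag t : f (fun=> t) = c + \sum_(p <- s1) p.1 * t ^+ p.2.
  rewrite f_split /s1 big_map big_filter; congr (_ + _).
  by apply: eq_bigr => p _; rewrite monomial_diag.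
have s1_deg : all (fun p => 0 < p.2)%N s1.
  apply/allP => _ /mapP[p + ->]; rewrite mem_filter => /andP[p0 _] /=.
  by rewrite lt0n.
have [cT|] := boolP (c \in @tangible F); last first.
  rewrite negbK => cG; exists (fun=> 0); split; first by right.
  rewrite /is_root f_diag big1_seq ?addr0 // => p /= /(allP s1_deg) p0.
  by rewrite expr0n eqn0Ngt p0 mulr0.
have [s1n0|s10] := boolP (has (fun p => p.1 != 0) s1).
  have [t tT te] := nu_sum_attains Fdiv cT s1_deg s1n0.
  exists (fun=> t); split; first by left.
  by rewrite /is_root f_diag (add_nu_eq _ _ (esym te)); apply: nu_ghost0.
case: fNmon; exists c, (fun=> 0%N); split => // x.
rewrite monomial_deg0; last by rewrite big1.
rewrite f_split big1_seq ?addr0 // => p /andP[p0 ps].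
have /(hasPn s10) : (p.1, deg p) \in s1.
  by apply/mapP; exists p; rewrite // mem_filter p0.
by rewrite negbK => /eqP /= p10; rewrite /monomial p10 mul0r.
Qed.
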